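(* Let $K$ be a compact Hausdorff topological space and $n$ a positive integer. The extreme points of the closed unit ball of the space $(\mathcal{P}_o(^nC(K)),\|\cdot\|_r)$ are the $n$-homogeneous polynomials $\pm\delta_t^n$, where $t\in K$ and $\delta_t^n(x)=x(t)^n$.
   Context: $C(K)$ is the Banach lattice of continuous real functions on $K$ with the supremum norm $\|\cdot\|_\infty$. An $n$-homogeneous polynomial on $C(K)$ is a function $P\colon C(K)\to\mathbb{R}$ of the form $P(x)=A(x,\dots,x)$ with $A$ a bounded $n$-linear form (taken to be the unique symmetric one). $P$ is orthogonally additive if $P(x+y)=P(x)+P(y)$ whenever $|x|\wedge|y|=0$; $\mathcal{P}_o(^nC(K))$ is the space of all such polynomials. It is known that every $P\in\mathcal{P}_o(^nC(K))$ has the form $P(x)=\int_K x^n\,d\mu$ for a regular Borel signed measure $\mu$. The $n$-homogeneous polynomials are ordered by: $\widehat A\le\widehat B$ if $A(x_1,\dots,x_n)\le B(x_1,\dots,x_n)$ for all $x_1,\dots,x_n\ge 0$, where $\widehat A(x)=A(x,\dots,x)$. Every orthogonally additive polynomial is regular (a difference of two positive $n$-homogeneous polynomials) and has an absolute value $|P|$ in this order, which for $P=\widehat A$ and $x\ge0$ satisfies $$|P|(x)=\sup\Bigl\{\sum_{i_1,\dots,i_n}|A(u^1_{i_1},\dots,u^n_{i_n})|: u^1,\dots,u^n\in\Pi(x)\Bigr\},$$ where $\Pi(x)$ is the set of all finite families of positive elements of $C(K)$ whose sum is $x$. The regular norm is $\|P\|_r=\|\,|P|\,\|_\infty$, where $\|Q\|_\infty=\sup\{|Q(x)|:\|x\|_\infty\le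 1\}$. *)

(* Defs.v *)
From HB Require Import structures.
From mathcomp Require Import all_boot all_order all_algebra all_fingroup.
From mathcomp Require Import all_classical all_reals all_analysis.

Set Implicit Arguments.
Unset Strict Implicit.
Unset Printing Implicit Defensive.

Import Order.TTheory GRing.Theory Num.Theory.
Import numFieldNormedType.Exports.

Local Open Scope classical_set_scope.
Local Open Scope ring_scope.

Definition cfun (R : realType) (K : topologicalType) : Type :=
  continuousType K R.

HB.instance Definition _ (R : realType) (K : topologicalType) :=
  Choice.copy (cfun R K) (continuousType K R).

Section CfunLmodule.
Variables (R : realType) (K : topologicalType).
Implicit Types x y z : cfun R K.

Lemma cfun_ext x y : (forall t, x t = y t) -> x = y.
Proof. by move=> xy; apply/continuousEP => t; exact: xy. Qed.

Lemma cfun0_cts : continuous (fun _ : K => 0 : R).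
Proof. by move=> t; exact: cvg_cst. Qed.

Lemma cfunN_cts x : continuous (fun t => - x t).
Proof. by move=> t; apply: cvgN; exact: cts_fun. Qed.

Lemma cfunD_cts x y : continuous (fun t => x t + y t).
Proof. by move=> t; apply: cvgD; exact: cts_fun. Qed.

Lemma cfunZ_cts (a : R) x : continuous (fun t => a * x t).
Proof. by move=> t; apply: cvgM; [exact: cvg_cst | exact: cts_fun]. Qed.

Definition cfun0 : cfun R K := mkcts cfun0_cts.
Definition cfunN x : cfun R K := mkcts (@cfunN_cts x).
Definition cfunD x y : cfun R K := mkcts (@cfunD_cts x y).
Definition cfunZ a x : cfun R K := mkcts (@cfunZ_cts a x).

Lemma cfunDA : associative cfunD.
Proof. by move=> x y z; apply: cfun_ext => t /=; exact: addrA. Qed.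
Lemma cfunDC : commutative cfunD.
Proof. by move=> x y; apply: cfun_ext => t /=; exact: addrC. Qed.
Lemma cfun0D : left_id cfun0 cfunD.
Proof. by move=> x; apply: cfun_ext => t /=; exact: add0r. Qed.
Lemma cfunND : left_inverse cfun0 cfunN cfunD.
Proof. by move=> x; apply: cfun_ext => t /=; exact: addNr. Qed.

HB.instance Definition _ :=
  GRing.isZmodule.Build (cfun R K) cfunDA cfunDC cfun0D cfunND.

Lemma cfunZA (a b : R) x : cfunZ a (cfunZ b x) = cfunZ (a * b) x.
Proof. by apply: cfun_ext => t /=; exact: mulrA. Qed.
Lemma cfunZ1 : left_id 1 cfunZ.
Proof. by move=> x; apply: cfun_ext => t /=; exact: mul1r. Qed.
Lemma cfunZDr : right_distributive cfunZ +%R.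
Proof. by move=> a x y; apply: cfun_ext => t /=; exact: mulrDr. Qed.
Lemma cfunZDl x : {morph cfunZ^~ x : a b / a + b}.
Proof. by move=> a b; apply: cfun_ext => t /=; exact: mulrDl. Qed.

HB.instance Definition _ := GRing.Zmodule_isLmodule.Build R (cfun R K)
  cfunZA cfunZ1 cfunZDr cfunZDl.

End CfunLmodule.

Section Polynomials.
Variables (R : realType) (K : topologicalType).
Implicit Types (x y : cfun R K) (P Q : cfun R K -> R) (n : nat).

(* [sup] is total: this is the uniform norm when K is nonempty and compact. *)
Definition supnorm x : R := sup (range (fun t => `|x t|)).

Definition cfun_ge0 x : Prop := forall t, 0 <= x t.

(* |x| /\ |y| = 0 in the (pointwise) lattice order *)
Definition cfun_disjoint x y : Prop :=
  forall t, Num.min `|x t| `|y t| = 0.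

Definition nform n := ('I_n -> cfun R K) -> R.

Definition multilinear n (A : nform n) : Prop :=
  forall (i : 'I_n) (x : 'I_n -> cfun R K),
    scalar (fun v : cfun R K => A (fun j => if j == i then v else x j)).

Definition bounded_form n (A : nform n) : Prop :=
  exists M : R, forall x : 'I_n -> cfun R K,
    `|A x| <= M * \prod_(i < n) supnorm (x i).

Definition form_symmetric n (A : nform n) : Prop :=
  forall (s : 'S_n) (x : 'I_n -> cfun R K), A (x \o s) = A x.

Definition diag_poly n (A : nform n) : cfun R K -> R := fun x => A (fun=> x).

Definition hom_polynomial n P : Prop :=
  exists A : nform n, [/\ multilinear A, bounded_form A & P = diag_poly A].

Definition associated_form P n (A : nform n) : Prop :=
  [/\ multilinear A, bounded_form A, form_symmetric A & P = diag_poly A].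

Definition orthogonally_additive P : Prop :=
  forall x y, cfun_disjoint x y -> P (x + y) = P x + P y.

Definition orth_polynomial n P : Prop :=
  hom_polynomial n P /\ orthogonally_additive P.

(* The form associated with a homogeneous polynomial exists and is unique, so
   the quantifiers on A and B only name the two forms. *)
Definition poly_le n P Q : Prop :=
  exists A B : nform n, [/\ associated_form P A, associated_form Q B &
    forall x : 'I_n -> cfun R K, (forall i, cfun_ge0 (x i)) -> A x <= B x].

(* Q is the least upper bound of P and - P among n-homogeneous polynomials. *)
Definition is_poly_abs n P Q : Prop :=
  [/\ hom_polynomial n Q, poly_le n P Q, poly_le n (- P) Q &
    forall S, hom_polynomial n S ->
      poly_le n P S -> poly_le n (- P) S -> poly_le n Q S].

(* The default value 0 is used only when P has no absolute value, which does
   not happen when P is orthogonally additive. *)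
Definition poly_abs n P : cfun R K -> R := xget 0 [set Q | is_poly_abs n P Q].

Definition poly_norm P : R := sup [set `|P x| | x in [set x | supnorm x <= 1]].

Definition regular_norm n P : R := poly_norm (poly_abs n P).

Definition regular_unit_ball n : set (cfun R K -> R) :=
  [set P | orth_polynomial n P /\ regular_norm n P <= 1].

Definition delta_pow n (t : K) : cfun R K -> R := fun x => x t ^+ n.

End Polynomials.

Definition extreme_points (R : realType) (V : lmodType R) (S : set V) : set V :=
  [set v | S v /\ forall (u w : V) (a : R), S u -> S w -> 0 < a < 1 ->
     v = a *: u + (1 - a) *: w -> u = v /\ w = v].

(* Main.v *)
Require Import Defs.
From HB Require Import structures.
From mathcomp Require Import all_boot all_order all_algebra.
From mathcomp Require Import all_classical all_reals all_analysis.
From mathcomp Require Import all_fingroup.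
From mathcomp Require Import ring lra zify.
Import Order.TTheory GRing.Theory Num.Theory.
Import numFieldNormedType.Exports.
Local Open Scope classical_set_scope.
Local Open Scope ring_scope.
Set Implicit Arguments.
Unset Strict Implicit.
Unset Printing Implicit Defensive.

(** The orthogonally additive [n]-homogeneous polynomials are the functions
[P x = phi (x ^+ n)] with [phi] a bounded linear functional on [C(K)]; under
this linear and injective correspondence the regular norm of [P] is the norm of
[phi].  The theorem is therefore the Arens-Kelley description of the extreme
points of the dual ball of [C(K)] as the functionals [phi f = f t] and
[phi f = - f t] ([extreme_points_dual_ball]).  No measures occur: [phi] itself
plays the role of the representing measure.

Representation ([form_of_product]).  Let [A] be the symmetric form of [P].
Polarization ([sym_diag0]) turns orthogonal additivity into [A x = 0] whenever
the entries split into two disjoint groups.  If merely two entries are disjoint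
one opens a gap between their supports and distributes the other entries over
the two sides by cut-offs ([gap_eq0], [disjoint_entries_eq0]).  Hence, with the
other entries fixed, [A] gives bounded bilinear forms [B] with [B f g = 0] for
disjoint [f] and [g], and such a form satisfies [B h 1 = B 1 h]
([bilin_swap01]): slicing [h] into [N] layers, only neighbouring layers
contribute to the difference, their contributions are bounded independently of
[N], and a factor [1 / N] remains.  So factors may be moved between entries,
and [A x] is a linear functional [phi] of the product of the entries.

Norm ([regular_norm_modulus]).  The absolute value of [phi (x ^+ n)] is
[psi (x ^+ n)] with [psi] the modulus of [phi] ([pow_poly_abs]); it is below
every polynomial that dominates both [P] and [- P], orthogonally additive or
not ([modulus_le_form]).  As [psi] is positive, the norm of its polynomial is
[psi 1], which is the norm of [phi].

Extreme points.  If [phi] is extreme and [0 <= h <= 1], the norms of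
[f |-> phi (h f)] and [f |-> phi ((1 - h) f)] add up to at most 1, so both are
multiples of [phi] ([extreme_proportional]).  Then [phi] is a multiple of a
multiplicative functional, which is an evaluation by compactness
([multiplicative_dirac]).  Conversely, two functionals of the ball with an
evaluation as a proper average are positive, and vanish where it does
([dirac_extreme]). *)

(** * Multilinear forms on a vector space *)

Section MultilinearForms.
Variables (R : realType) (V : lmodType R) (n : nat).
Implicit Types (A B : ('I_n -> V) -> R) (x : 'I_n -> V) (i j : 'I_n).

Definition upd x i v : 'I_n -> V := fun j => if j == i then v else x j.

Definition mlin A := forall i x a u v,
  A (upd x i (a *: u + v)) = a * A (upd x i u) + A (upd x i v).

Definition sym A := forall (s : 'S_n) x, A (x \o s) = A x.

Lemma upd_id x i : upd x i (x i) = x.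
Proof. by apply/funext => j; rewrite /upd; case: eqVneq => [->|]. Qed.

Lemma upd_eq x i v : upd x i v i = v.
Proof. by rewrite /upd eqxx. Qed.

Lemma upd_ne x i v j : j != i -> upd x i v j = x j.
Proof. by rewrite /upd => /negPf ->. Qed.

Lemma upd_upd x i u v : upd (upd x i u) i v = upd x i v.
Proof. by apply/funext => j; rewrite /upd; case: (j == i). Qed.

Lemma updC x i j u v : i != j -> upd (upd x i u) j v = upd (upd x j v) i u.
Proof.
move=> ij; apply/funext => k; rewrite /upd.
by case: (eqVneq k j) => [->|//]; rewrite eq_sym (negPf ij).
Qed.

Section Laws.
Variable A : ('I_n -> V) -> R.
Hypothesis lA : mlin A.

Lemma mlinD i x u v : A (upd x i (u + v)) = A (upd x i u) + A (upd x i v).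
Proof. by rewrite -[u]scale1r lA scale1r mul1r. Qed.

Lemma mlin0 i x : A (upd x i 0) = 0.
Proof.
by apply: (@addrI _ (A (upd x i 0))); rewrite -mlinD !addr0.
Qed.

Lemma mlinZ i x a u : A (upd x i (a *: u)) = a * A (upd x i u).
Proof. by rewrite -[a *: u]addr0 lA mlin0 addr0. Qed.

Lemma mlinB i x u v : A (upd x i (u - v)) = A (upd x i u) - A (upd x i v).
Proof. by rewrite mlinD -scaleN1r mlinZ mulN1r. Qed.

Lemma mlin_eq0 x i : x i = 0 -> A x = 0.
Proof. by move=> xi0; rewrite -[x](upd_id _ i) xi0 mlin0. Qed.

(** Along the line from [u] in the direction [v] a multilinear form is a
polynomial; its linear coefficient is the sum of the partial derivatives.  The
slots outside [s] keep the entries of [w], which is what the induction varies. *)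
Lemma mlin_line (s : seq 'I_n) (u v w : 'I_n -> V) : uniq s ->
  exists p : {poly R},
    [/\ forall t, p.[t] = A (fun i => if i \in s then u i + t *: v i else w i),
        p`_0 = A (fun i => if i \in s then u i else w i)
      & p`_1 = \sum_(i <- s)
          A (fun j => if j \in s then (if j == i then v j else u j) else w j)].
Proof.
elim: s w => [|a s IH] w.
  move=> _; exists (A w)%:P; split=> [t||]; rewrite ?hornerC ?coefC ?big_nil //.
move=> /= /andP[aNs us].
have [p [pE p0 p1]] := IH (upd w a (u a)) us.
have [q [qE q0 q1]] := IH (upd w a (v a)) us.
have cons_upd (f : 'I_n -> V) (g : 'I_n -> V) : f a = g a ->
    (fun i => if i \in a :: s then f i else w i) =
    (fun i => if i \in s then f i else upd w a (g a) i).
  move=> fg; apply/funext => i; rewrite inE /upd.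
  by case: (eqVneq i a) => [->|//]; rewrite (negPf aNs) fg.
have outer_upd (f : 'I_n -> V) b :
    (fun i => if i \in s then f i else upd w a b i) =
    upd (fun i => if i \in s then f i else w i) a b.
  apply/funext => i; rewrite /upd.
  by case: (eqVneq i a) => [->|//]; rewrite (negPf aNs).
exists (p + q * 'X); split=> [t||].
- rewrite !hornerE pE qE.
  rewrite (cons_upd (fun i => u i + t *: v i) (fun i => u i + t *: v i)) //.
  by rewrite !outer_upd addrC [u a + _]addrC lA mulrC.
- by rewrite coefD coefMX eqxx addr0 p0 (cons_upd u u).
- rewrite coefD coefMX /= p1 q0 big_cons addrC; congr (_ + _).
    rewrite (cons_upd (fun j => if j == a then v j else u j) v) ?eqxx //.
    congr A; apply/funext => j; case: ifP => // js.
    by case: (eqVneq j a) js aNs => [->->|].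
  apply: eq_big_seq => i si.
  rewrite (cons_upd (fun j => if j == i then v j else u j) u) //.
  by case: eqVneq si aNs => // -> ->.
Qed.

Lemma poly_eq0_horner (p : {poly R}) : (forall t, p.[t] = 0) -> p = 0.
Proof.
move=> p0; apply/eqP/negP => /negP pn0.
pose rs := [seq k%:R : R | k <- iota 0 (size p)].
have := max_poly_roots pn0 (rs := rs).
rewrite size_map size_iota ltnn => H; suff: false by [].
apply: H; first by apply/allP => t _; apply/eqP.
rewrite map_inj_uniq ?iota_uniq // => i j /eqP; rewrite eqr_nat.
by move/eqP.
Qed.

(** Polarization.  Differentiating [A (y, ..., y) = 0] frees one slot after the
other: by symmetry the partial derivatives in the slots still filled with [y]
all agree, so that each of them vanishes. *)
Lemma sym_diag0 : sym A -> (forall y, A (fun=> y) = 0) -> forall x, A x = 0.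
Proof.
move=> sA A0 x.
suff H (s : seq 'I_n) : uniq s ->
    forall y, A (fun i => if i \in s then x i else y) = 0.
  by have := H (enum 'I_n) (enum_uniq _) 0; under eq_fun do rewrite mem_enum.
elim: s => [_ y|a s IH /= /andP[aNs us] y]; first exact: A0.
pose r := [seq i <- enum 'I_n | i \notin s].
have rE i : (i \in r) = (i \notin s) by rewrite mem_filter mem_enum andbT.
have [] := @mlin_line r (fun=> y) (fun=> x a) x.
  by rewrite filter_uniq // enum_uniq.
move=> p [pE _ p1].
have p0 : p = 0.
  apply: poly_eq0_horner => t; rewrite pE -[RHS](IH us (y + t *: x a)).
  by congr A; apply/funext => i; rewrite rE if_neg.
set T := A _.
suff E : p`_1 = (size r)%:R * T.
  move: E; rewrite p0 coef0 => /esym/eqP; rewrite mulf_eq0 pnatr_eq0 size_eq0.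
  by case/orP=> [/eqP r0|/eqP//]; move: (rE a); rewrite r0 aNs.
rewrite p1 (eq_big_seq (fun=> T)) => [|i].
  by rewrite big_const_seq count_predT iter_addr_0 mulr_natl.
rewrite rE => iNs; rewrite /T -(sA (tperm i a)); congr A; apply/funext => j /=.
rewrite rE if_neg inE.
case: tpermP => [->|->|/eqP ji /eqP ja].
- by rewrite (negPf aNs) (negPf iNs) orbF; case: (eqVneq i a) => [->|].
- by rewrite (negPf iNs) !eqxx.
- by rewrite (negPf ji) (negPf ja) /=.
Qed.

End Laws.

Lemma mlin_sub A B : mlin A -> mlin B -> mlin (fun x => A x - B x).
Proof. by move=> lA lB i x a u v; rewrite lA lB; ring. Qed.

(** The symmetric form generating a polynomial is unique. *)
Lemma sym_diag_inj A B : mlin A -> mlin B -> sym A -> sym B ->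
  (forall y, A (fun=> y) = B (fun=> y)) -> A = B.
Proof.
move=> lA lB sA sB AB; apply/funext => x; apply/eqP; rewrite -subr_eq0; apply/eqP.
apply: (sym_diag0 (mlin_sub lA lB)) => [s z|y]; first by rewrite sA sB.
by rewrite AB subrr.
Qed.

(** Writing the entries one after the other as differences of elements of [S]
reduces everything to entries in [S]; for the positive cone this shows that
the values on positive functions determine a form. *)
Lemma mlin_cone_eq0 A (S : V -> Prop) : mlin A ->
  (forall v, exists p q, [/\ S p, S q & v = p - q]) ->
  (forall x, (forall i, S (x i)) -> A x = 0) -> forall x, A x = 0.
Proof.
move=> lA Sgen A0 x.
suff H (s : seq 'I_n) : forall x, (forall i, i \notin s -> S (x i)) -> A x = 0.
  by apply: (H (enum 'I_n)) => i; rewrite mem_enum.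
elim: s => [|a s IH] {}x Sx; first by apply: A0 => i; exact: Sx.
have [p [q [Sp Sq xa]]] := Sgen (x a).
rewrite -[x](upd_id _ a) xa mlinB // !IH ?subrr // => i si.
  by rewrite /upd; case: eqVneq => // ia; apply: Sx; rewrite inE negb_or ia.
by rewrite /upd; case: eqVneq => // ia; apply: Sx; rewrite inE negb_or ia.
Qed.

End MultilinearForms.

Lemma mlin_comp (R : realType) (V W : lmodType R) n (A : ('I_n -> W) -> R)
  (L : V -> W) : mlin A -> (forall a u v, L (a *: u + v) = a *: L u + L v) ->
  mlin (fun x => A (L \o x)).
Proof.
move=> lA lL i x a u v.
have E w : L \o upd x i w = upd (L \o x) i (L w).
  by apply/funext => j; rewrite /= /upd; case: ifP.
by rewrite !E lL lA.
Qed.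

(** * Pointwise operations on continuous functions *)

Section ContinuousFunctions.
Variables (R : realType) (K : topologicalType).
Local Notation C := (cfun R K).
Implicit Types (x y : C) (t : K).

Lemma cfunM_cts x y : continuous (fun t => x t * y t).
Proof. by move=> t; apply: cvgM; exact: cts_fun. Qed.

Lemma cfun_cst_cts (c : R) : continuous (fun _ : K => c).
Proof. by move=> t; exact: cvg_cst. Qed.

Lemma cfun_abs_cts x : continuous (fun t => `|x t|).
Proof. by move=> t; apply: cvg_norm; exact: cts_fun. Qed.

Lemma cfun_max_cts x y : continuous (fun t => Num.max (x t) (y t)).
Proof. by move=> t; apply: continuous_max; exact: cts_fun. Qed.

Lemma cfun_min_cts x y : continuous (fun t => Num.min (x t) (y t)).
Proof. by move=> t; apply: continuous_min; exact: cts_fun. Qed.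

Lemma cfun_inv_cts x : (forall t, x t != 0) -> continuous (fun t => (x t)^-1).
Proof. by move=> x0 t; apply: cvgV; [exact: x0 | exact: cts_fun]. Qed.

Definition cmul x y : C := mkcts (@cfunM_cts x y).
Definition ccst c : C := mkcts (@cfun_cst_cts c).
Definition cabs x : C := mkcts (@cfun_abs_cts x).
Definition cmax x y : C := mkcts (@cfun_max_cts x y).
Definition cmin x y : C := mkcts (@cfun_min_cts x y).
Definition cinv x (x0 : forall t, x t != 0) : C := mkcts (cfun_inv_cts x0).

Lemma cmulA : associative cmul.
Proof. by move=> x y z; apply: cfun_ext => t /=; exact: mulrA. Qed.
Lemma cmulC : commutative cmul.
Proof. by move=> x y; apply: cfun_ext => t /=; exact: mulrC. Qed.
Lemma cmul1 : left_id (ccst 1) cmul.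
Proof. by move=> x; apply: cfun_ext => t /=; exact: mul1r. Qed.
Lemma cmulDl : left_distributive cmul +%R.
Proof. by move=> x y z; apply: cfun_ext => t /=; exact: mulrDl. Qed.

HB.instance Definition _ :=
  GRing.Zmodule_isComPzRing.Build (cfun R K) cmulA cmulC cmul1 cmulDl.

Lemma cfun0E t : (0 : C) t = 0. Proof. by []. Qed.
Lemma cfun1E t : (1 : C) t = 1. Proof. by []. Qed.
Lemma cfunDE x y t : (x + y) t = x t + y t. Proof. by []. Qed.
Lemma cfunNE x t : (- x) t = - x t. Proof. by []. Qed.
Lemma cfunZE a x t : (a *: x) t = a * x t. Proof. by []. Qed.
Lemma cfunME x y t : (x * y) t = x t * y t. Proof. by []. Qed.
Lemma ccstE c t : ccst c t = c. Proof. by []. Qed.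
Lemma cabsE x t : cabs x t = `|x t|. Proof. by []. Qed.
Lemma cmaxE x y t : cmax x y t = Num.max (x t) (y t). Proof. by []. Qed.
Lemma cminE x y t : cmin x y t = Num.min (x t) (y t). Proof. by []. Qed.
Lemma cinvE x (xn0 : forall t, x t != 0) t : cinv xn0 t = (x t)^-1. Proof. by []. Qed.

Definition cfunE := (cfun0E, cfun1E, cfunDE, cfunNE, cfunZE, cfunME, ccstE,
  cabsE, cmaxE, cminE, cinvE).

Lemma cfunXE x m t : (x ^+ m) t = x t ^+ m.
Proof. by elim: m => [|m IH]; rewrite ?expr0 // !exprS cfunME IH. Qed.

Lemma cfun_sumE (I : Type) (s : seq I) (P : pred I) (F : I -> C) t :
  (\sum_(i <- s | P i) F i) t = \sum_(i <- s | P i) F i t.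
Proof. exact: (big_morph (fun x : C => x t)). Qed.

Lemma cfun_prodE (I : Type) (s : seq I) (P : pred I) (F : I -> C) t :
  (\prod_(i <- s | P i) F i) t = \prod_(i <- s | P i) F i t.
Proof. exact: (big_morph (fun x : C => x t)). Qed.

Lemma cfun_scaleAl a x y : (a *: x) * y = a *: (x * y).
Proof. by apply: cfun_ext => t; rewrite !cfunE mulrA. Qed.

Lemma cfun_scaleAr a x y : x * (a *: y) = a *: (x * y).
Proof. by rewrite mulrC cfun_scaleAl mulrC. Qed.

Lemma cfun_posneg x : x = cmax x 0 - cmax (- x) 0.
Proof.
apply: cfun_ext => t; rewrite !cfunE.
by case: (leP (x t) 0); case: (leP (- x t) 0); lra.
Qed.

Lemma cfun_disjointP x y : cfun_disjoint x y <-> forall t, x t = 0 \/ y t = 0.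
Proof.
split=> xy t.
  by have := xy t; case: leP => _ /eqP; rewrite normr_eq0 => /eqP; [left|right].
have [->|->] := xy t; rewrite normr0; first by rewrite min_l.
by rewrite min_r.
Qed.

Hypothesis K_compact : compact [set: K].

Lemma cfun_bounded x : exists M, 0 <= M /\ forall t, `|x t| <= M.
Proof.
have : compact (range x).
  apply: continuous_compact => //; apply: continuous_subspaceT; exact: cts_fun.
move/compact_bounded => [M [Mr xM]].
exists (Num.max M 0 + 1); split; first by case: (leP M 0); lra.
by move=> t; apply: (xM (Num.max M 0 + 1)); [case: (leP M 0); lra | exists t].
Qed.

Lemma cfun_span01 x : exists a b y,
  (forall t, 0 <= y t <= 1) /\ x = a *: y + b *: (1 : C).
Proof.
have [c [c0 xc]] := cfun_bounded x.
have c1 : 0 < c + 1 by rewrite ltr_wpDl.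
exists (2 * (c + 1)), (- (c + 1)), ((2 * (c + 1))^-1 *: (x + (c + 1) *: (1 : C))).
split=> [t|]; last by apply: cfun_ext => t; rewrite !cfunE; field; lra.
rewrite !cfunE mulr1 mulrC.
have := xc t; rewrite ler_norml => /andP[x1 x2].
by rewrite ler_pdivlMr ?ler_pdivrMr; lra.
Qed.

Lemma le_supnorm x t : `|x t| <= supnorm x.
Proof.
have [M [_ xM]] := cfun_bounded x.
apply: ub_le_sup; last by exists t.
by exists M => _ [s _ <-].
Qed.

Hypothesis K_nonempty : [set: K] !=set0.

Lemma supnorm_le x c : (forall t, `|x t| <= c) -> supnorm x <= c.
Proof.
have [t0 _] := K_nonempty.
move=> xc; apply: ge_sup; first by exists `|x t0|, t0.
by move=> _ [t _ <-].
Qed.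

Lemma supnorm_leP x c : supnorm x <= c <-> forall t, `|x t| <= c.
Proof.
split; last exact: supnorm_le.
by move=> xc t; exact: le_trans (le_supnorm x t) xc.
Qed.

Lemma supnorm_ge0 x : 0 <= supnorm x.
Proof. by have [t0 _] := K_nonempty; exact: le_trans (le_supnorm x t0). Qed.

End ContinuousFunctions.

(** * Orthogonally additive forms vanish on disjoint entries *)

Lemma norm_le_eps_eq0 (R : realFieldType) (a M : R) :
  (forall e, 0 < e -> `|a| <= M * e) -> a = 0.
Proof.
move=> H; apply/eqP; rewrite -normr_le0; apply/ler_addgt0Pl => e e0; rewrite addr0.
have M1 : 0 < `|M| + 1 by rewrite ltr_wpDl.
apply: le_trans (H (e / (`|M| + 1)) (divr_gt0 e0 M1)) _.
rewrite mulrA ler_pdivrMr // mulrC ler_pM2l //.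
by rewrite (le_trans (ler_norm _)) // lerDl.
Qed.

Section DisjointEntries.
Variables (R : realType) (K : topologicalType) (n : nat).
Local Notation C := (cfun R K).
Variable A : nform R K n.
Hypotheses (lA : mlin A) (sA : sym A).
Hypothesis oA : orthogonally_additive (diag_poly A).
Implicit Types (x : 'I_n -> C) (s : pred 'I_n).

(** When the entries split into two mutually disjoint groups, all their linear
combinations stay disjoint, so orthogonal additivity is an identity between
two polynomials in the coefficients of these combinations.  Polarizing it
isolates [A x]. *)
Lemma two_groups_eq0 x s a b : s a -> ~~ s b ->
  (forall t, (forall i, s i -> x i t = 0) \/ (forall i, ~~ s i -> x i t = 0)) ->
  A x = 0.
Proof.
move=> sa sb xs.
pose L s' (c : 'rV[R]_n) : C := \sum_(i | s' i) c 0 i *: x i.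
have lL s' k c d : L s' (k *: c + d) = k *: L s' c + L s' d.
  rewrite /L scaler_sumr -big_split; apply: eq_bigr => i _.
  by rewrite !mxE scalerDl scalerA.
have L1 s' k : L s' (delta_mx 0 k) = if s' k then x k else 0.
  rewrite /L; case: ifP => sk.
    rewrite (bigD1 k) //= big1 ?addr0 ?mxE ?eqxx ?scale1r // => i /andP[_ ik].
    by rewrite mxE (negPf ik) andbF scale0r.
  rewrite big1 // => i si; rewrite mxE.
  by case: (eqVneq i k) => [ik|_]; [rewrite -ik si in sk | rewrite andbF scale0r].
pose s' := fun i => ~~ s i.
(* The diagonal of B expresses orthogonal additivity; at the unit vectors its
two subtracted terms have a zero entry. *)
pose B (c : 'I_n -> 'rV[R]_n) :=
  A ((fun d => L s d + L s' d) \o c) - A (L s \o c) - A (L s' \o c).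
have lB : mlin B.
  apply: mlin_sub; last exact: (mlin_comp lA (lL s')).
  apply: mlin_sub; last exact: (mlin_comp lA (lL s)).
  by apply: mlin_comp lA _ => k c d; rewrite !lL scalerDr addrACA.
have sB : sym B.
  move=> p c; rewrite /B.
  by rewrite -(sA p (_ \o c)) -(sA p (L s \o c)) -(sA p (L s' \o c)).
have dB c : B (fun=> c) = 0.
  rewrite /B -addrA -opprD; apply/eqP; rewrite subr_eq0; apply/eqP.
  apply: oA; apply/cfun_disjointP => t; rewrite !cfun_sumE.
  by case: (xs t) => x0; [left|right]; apply: big1 => i si;
    rewrite cfunE x0 // mulr0.
pose c0 : 'I_n -> 'rV[R]_n := fun k => delta_mx 0 k.
have := sym_diag0 lB sB dB c0; rewrite /B.
rewrite (@mlin_eq0 _ _ _ _ lA (L s \o c0) b); last first.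
  by rewrite /= L1 (negPf sb).
rewrite (@mlin_eq0 _ _ _ _ lA (L s' \o c0) a); last by rewrite /= L1 /s' sa.
rewrite !subr0 => <-; congr A; apply/funext => k /=; rewrite !L1 /s'.
by case: (s k); rewrite ?addr0 ?add0r.
Qed.

(** The remaining entries, listed in [r], may be arbitrary if a gap [b < y < c]
separates the two groups: a cut-off in the middle third of the gap splits one more entry
into a part that joins the first group and a part that joins the second, and
a third of the gap is left in either case. *)
Lemma gap_eq0 (y : C) (r : seq 'I_n) : forall x s b c i j, b < c ->
  i \notin r -> s i -> j \notin r -> ~~ s j ->
  (forall k t, k \notin r -> s k -> y t <= c -> x k t = 0) ->
  (forall k t, k \notin r -> ~~ s k -> b <= y t -> x k t = 0) -> A x = 0.
Proof.
elim: r => [|k r IH] x s b c i j bc ir si jr sj xc xb.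
  apply: (two_groups_eq0 si sj) => t.
  have [yc|yc] := leP (y t) c; [left|right] => l sl; first exact: xc.
  by apply: xb => //; lra.
move: ir jr; rewrite !inE !negb_or => /andP[ik ir] /andP[jk jr].
pose e := (c - b) / 3.
have e0 : 0 < e by rewrite /e; lra.
pose u : C := cmin (cmax (e^-1 *: (y - ccst K (b + e))) 0) 1.
have u0 t : y t <= b + e -> u t = 0.
  move=> ye; rewrite !cfunE max_r ?min_l //.
  by rewrite pmulr_rle0 ?invr_gt0 // subr_le0.
have u1 t : b + 2 * e <= y t -> u t = 1.
  move=> ye; have e1 : 1 <= e^-1 * (y t - (b + e)) by rewrite ler_pdivlMl //; lra.
  by rewrite !cfunE max_l ?min_r // (le_trans _ e1).
rewrite -[x](upd_id _ k) -[x k]mul1r -[1](subrK u) mulrDl mlinD //.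
rewrite (IH _ (fun l => (l != k) && s l) (b + 2 * e) c i j) ?ik ?(negPf jk) //.
- rewrite (IH _ (fun l => (l == k) || s l) b (b + e) i j) ?si ?orbT ?addr0 //.
  + by rewrite ltrDl.
  + by rewrite (negPf jk).
  + move=> l t lr; rewrite /upd; case: eqVneq => [_ _ ye|lk sl ye].
      by rewrite cfunE u0 ?mul0r.
    by apply: xc => //; [rewrite inE negb_or lk | rewrite /e in ye; lra].
  + move=> l t lr; rewrite /upd; case: eqVneq => //= lk sl ye.
    by apply: xb => //; rewrite inE negb_or lk.
- by rewrite /e; lra.
- move=> l t lr; rewrite /upd; case: eqVneq => //= lk sl ye.
  by apply: xc => //; rewrite inE negb_or lk.
- move=> l t lr; rewrite /upd; case: eqVneq => [_ _ ye|lk sl ye].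
    by rewrite cfunME cfunDE cfunNE u1 // subrr mul0r.
  by apply: xb => //; [rewrite inE negb_or lk | rewrite /e in ye; lra].
Qed.

Hypothesis K_compact : compact [set: K].
Hypothesis K_nonempty : [set: K] !=set0.
Hypothesis bA : bounded_form A.

Lemma bounded_form_entry x i :
  exists2 M, 0 <= M & forall v, `|A (upd x i v)| <= M * supnorm v.
Proof.
have [M AM] := bA.
exists (`|M| * \prod_(j < n | j != i) supnorm (x j)).
  by rewrite mulr_ge0 // prodr_ge0 // => j _; exact: supnorm_ge0.
move=> v; apply: le_trans (AM _) _.
rewrite (bigD1 i) //= upd_eq mulrCA mulrC.
rewrite (eq_bigr (fun j => supnorm (x j))) => [|j ji]; last by rewrite upd_ne.
rewrite ler_wpM2r ?supnorm_ge0 // ler_wpM2r ?ler_norm //.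
by rewrite prodr_ge0 // => j _; exact: supnorm_ge0.
Qed.

(** Truncating [x i] at height [e] opens a gap between its support and that of
[x j], at the price of an error of norm at most [e]. *)
Lemma disjoint_entries_eq0 x i j : i != j -> cfun_disjoint (x i) (x j) -> A x = 0.
Proof.
move=> ij /cfun_disjointP xij.
have [M M0 AM] := bounded_form_entry x i.
apply: (@norm_le_eps_eq0 _ _ M) => e e0.
pose z : C := cmax (x i - ccst K e) 0 - cmax (- x i - ccst K e) 0.
have xz t : `|(x i - z) t| <= e.
  rewrite !cfunE ler_norml.
  by case: (leP (x i t - e) 0); case: (leP (- x i t - e) 0); lra.
have zE t : `|x i t| <= e -> z t = 0.
  by rewrite ler_norml !cfunE => /andP[xe1 xe2]; rewrite !max_r ?subrr //; lra.
suff Az : A (upd x i z) = 0.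
  rewrite -[x](upd_id _ i) -[x i](subrK z) mlinD // Az addr0.
  by apply: le_trans (AM _) _; rewrite ler_wpM2l // supnorm_le.
pose r := [seq k <- enum 'I_n | (k != i) && (k != j)].
have rE k : (k \in r) = (k != i) && (k != j).
  by rewrite mem_filter mem_enum andbT.
apply: (@gap_eq0 (cabs (x i)) r _ (pred1 i) (e / 2) e i j); rewrite ?rE /= ?eqxx ?andbF //.
- by lra.
- by rewrite eq_sym.
- by move=> k t _ /eqP -> /zE; rewrite upd_eq.
- move=> k t; rewrite rE negb_and !negbK => kij ki.
  move: kij; rewrite (negPf ki) /= => /eqP -> xe.
  rewrite upd_ne 1?eq_sym //; case: (xij t) => // xi0.
  by move: xe; rewrite cabsE xi0 normr0; lra.
Qed.

End DisjointEntries.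

(** * Moving factors between entries *)

Section Hats.
Variable R : realType.
Implicit Types (y : R) (k : nat).

Definition clip y : R := Num.min (Num.max y 0) 1.

Lemma clip_cases y : [\/ y <= 0 /\ clip y = 0, 0 <= y <= 1 /\ clip y = y
  | 1 <= y /\ clip y = 1].
Proof.
rewrite /clip; case: (leP y 0) => y0.
  by constructor 1; rewrite min_l.
case: (leP y 1) => y1; first by constructor 2; split=> //; rewrite ltW.
by constructor 3; rewrite ltW.
Qed.

(** The ramp climbs from 0 to 1 between [k - 1] and [k]; the hat peaks at [k]. *)
Definition ramp y k : R := clip (y + 1 - k%:R).
Definition hat y k : R := ramp y k - ramp y k.+1.

Lemma ramp_0 y k : y <= k%:R -> ramp y k.+1 = 0.
Proof. by rewrite /ramp -natr1 => yk; case: (clip_cases (y + 1 - (k%:R + 1))); lra. Qed.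

Lemma ramp_1 y k : k%:R <= y -> ramp y k = 1.
Proof. by rewrite /ramp => yk; case: (clip_cases (y + 1 - k%:R)); lra. Qed.

Lemma hat_ge0 y k : 0 <= hat y k.
Proof.
rewrite /hat /ramp -natr1.
by case: (clip_cases (y + 1 - k%:R)); case: (clip_cases (y + 1 - (k%:R + 1))); lra.
Qed.

Lemma hat_supp y k : hat y k != 0 -> k%:R - 1 < y /\ y < k%:R + 1.
Proof.
rewrite /hat /ramp -natr1 => /eqP h0.
case: (clip_cases (y + 1 - k%:R)) h0; case: (clip_cases (y + 1 - (k%:R + 1))); lra.
Qed.

Lemma sum_ramp y m : 0 <= y -> \sum_(k < m) ramp y k.+1 = Num.min y m%:R.
Proof.
move=> y0; elim: m => [|m IH]; first by rewrite big_ord0 min_r.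
rewrite big_ord_recr /= IH /ramp -natr1.
by case: (leP y m%:R); case: (leP y (m%:R + 1));
  case: (clip_cases (y + 1 - (m%:R + 1))); lra.
Qed.

(** The hats telescope, and dropping some of them can only lower the sum. *)
Lemma sum_hat y m n (P : pred nat) :
  0 <= \sum_(m <= k < n | P k) hat y k <= 1.
Proof.
rewrite sumr_ge0 => [|k _]; last exact: hat_ge0.
have ramp01 k : 0 <= ramp y k <= 1.
  by rewrite /ramp; case: (clip_cases (y + 1 - k%:R)); lra.
have [nm|mn] := leqP n m; first by rewrite big_geq ?ler01.
apply: (@le_trans _ _ (\sum_(m <= k < n) hat y k)).
  by rewrite [leRHS](bigID P) /= lerDl sumr_ge0 // => k _; exact: hat_ge0.
rewrite -[leLHS]opprK -sumrN.
under eq_bigr do rewrite /hat opprB.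
by rewrite telescope_sumr ?(ltnW mn) //; have := ramp01 m; have := ramp01 n; lra.
Qed.

End Hats.

Section Balance.
Variables (R : realType) (K : topologicalType).
Local Notation C := (cfun R K).
Hypothesis K_compact : compact [set: K].

Definition bilin (B : C -> C -> R) :=
  (forall a u v g, B (a *: u + v) g = a * B u g + B v g) /\
  (forall a u v f, B f (a *: u + v) = a * B f u + B f v).

Definition unit_bounded (B : C -> C -> R) (M : R) := forall f g : C,
  (forall t, `|f t| <= 1) -> (forall t, `|g t| <= 1) -> `|B f g| <= M.

Definition orthosym (B : C -> C -> R) := forall f g : C,
  (forall t, f t = 0 \/ g t = 0) -> B f g = 0.

Section Bilinear.
Variables (B : C -> C -> R) (M : R).
Hypotheses (lB : bilin B) (bB : unit_bounded B M) (oB : orthosym B).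

Lemma bilinDl u v g : B (u + v) g = B u g + B v g.
Proof. by have := lB.1 1 u v g; rewrite scale1r mul1r. Qed.

Lemma bilinDr u v f : B f (u + v) = B f u + B f v.
Proof. by have := lB.2 1 u v f; rewrite scale1r mul1r. Qed.

Lemma bilin0l g : B 0 g = 0.
Proof. by apply: oB => t; left; rewrite cfun0E. Qed.

Lemma bilin0r f : B f 0 = 0.
Proof. by apply: oB => t; right; rewrite cfun0E. Qed.

Lemma bilinZl a u g : B (a *: u) g = a * B u g.
Proof. by rewrite -[a *: u]addr0 lB.1 bilin0l addr0. Qed.

Lemma bilinZr a u f : B f (a *: u) = a * B f u.
Proof. by rewrite -[a *: u]addr0 lB.2 bilin0r addr0. Qed.

Lemma bilinBl u v g : B (u - v) g = B u g - B v g.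
Proof. by rewrite bilinDl -scaleN1r bilinZl mulN1r. Qed.

Lemma bilinBr u v f : B f (u - v) = B f u - B f v.
Proof. by rewrite bilinDr -scaleN1r bilinZr mulN1r. Qed.

Lemma bilin_suml (I : Type) (s : seq I) (P : pred I) (F : I -> C) g :
  B (\sum_(i <- s | P i) F i) g = \sum_(i <- s | P i) B (F i) g.
Proof.
by apply: (big_morph (fun u => B u g)) => [u v|]; rewrite ?bilinDl ?bilin0l.
Qed.

Lemma bilin_sumr (I : Type) (s : seq I) (P : pred I) (F : I -> C) f :
  B f (\sum_(i <- s | P i) F i) = \sum_(i <- s | P i) B f (F i).
Proof.
by apply: (big_morph (fun u => B f u)) => [u v|]; rewrite ?bilinDr ?bilin0r.
Qed.

Variables (y : C).

Definition cramp k : C := cmin (cmax (y + ccst K (1 - k%:R)) 0) 1.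
Definition chat k : C := cramp k - cramp k.+1.

Lemma crampE k t : cramp k t = ramp (y t) k.
Proof. by rewrite /ramp -addrA. Qed.

Lemma chatE k t : chat k t = hat (y t) k.
Proof. by rewrite /hat -!crampE. Qed.

(** Hats whose indices agree modulo 3 interact with their own neighbour only,
so the sum over one residue class is a single value of [B] at two functions
between 0 and 1: the bound does not grow with [N]. *)
Lemma sum_neighbours_bounded N :
  `|\sum_(0 <= k < N) B (chat k.+1) (chat k)| <= 3 * M.
Proof.
have res (c : nat) : `|\sum_(0 <= k < N | (k %% 3 == c)%N) B (chat k.+1) (chat k)| <= M.
  pose p := \sum_(0 <= k < N | (k %% 3 == c)%N) chat k.+1.
  pose q := \sum_(0 <= k < N | (k %% 3 == c)%N) chat k.
  have -> : \sum_(0 <= k < N | (k %% 3 == c)%N) B (chat k.+1) (chat k) = B p q.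
    rewrite bilin_suml !big_mkord; apply: eq_bigr => k kc.
    rewrite bilin_sumr big_mkord (bigD1 k) //= big1 ?addr0 // => l /andP[lc lk].
    apply: oB => t; rewrite !chatE.
    case: (eqVneq (hat (y t) k.+1) 0) => [|/hat_supp[k1 k2]]; first by left.
    case: (eqVneq (hat (y t) l) 0) => [|/hat_supp[l1 l2]]; first by right.
    exfalso; move: lk; rewrite -val_eqE /= => lk.
    (* distinct indices in the same class are at least 3 apart, while the
       supports of the hats k + 1 and l have length 2 *)
    have [kl|kl] : (k + 3 <= l)%N \/ (l + 3 <= k)%N by lia.
      by have := ler_nat R (k + 3) l; rewrite kl natrD; move: k2; rewrite -natr1; lra.
    by have := ler_nat R (l + 3) k; rewrite kl natrD; move: k1; rewrite -natr1; lra.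
  apply: bB => t; rewrite cfun_sumE ler_norml.
    under eq_bigr do rewrite chatE.
    have := sum_hat (y t) 1 N.+1 (fun k => k.-1 %% 3 == c)%N.
    by rewrite big_add1 /=; lra.
  under eq_bigr do rewrite chatE.
  by have := sum_hat (y t) 0 N (fun k => k %% 3 == c)%N; lra.
have -> : \sum_(0 <= k < N) B (chat k.+1) (chat k) =
    \sum_(c < 3) \sum_(0 <= k < N | (k %% 3 == c)%N) B (chat k.+1) (chat k).
  rewrite (exchange_big_dep predT) //=; apply: eq_bigr => k _.
  by rewrite (bigD1 (Ordinal (ltn_pmod k (isT : 0 < 3)%N))) //= big1 ?addr0 //
    => c /andP[/eqP kc]; rewrite -val_eqE /= kc eqxx.
apply: le_trans (ler_norm_sum _ _ _) _.
apply: (@le_trans _ _ (\sum_(c < 3) M)); first by apply: ler_sum => c _; exact: res.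
by rewrite sumr_const card_ord mulr_natl.
Qed.

End Bilinear.

(** A function [0 <= h <= 1] is the mean of the [N] ramps of [N h].  Exchanging
the two arguments of [B (ramp, 1)] only costs values of [B] at neighbouring
hats, so that [N (B (h, 1) - B (1, h))] stays bounded as [N] grows. *)
Lemma bilin_swap01 B M (h : C) : bilin B -> unit_bounded B M -> orthosym B ->
  (forall t, 0 <= h t <= 1) -> B h 1 = B 1 h.
Proof.
move=> lB bB oB h01; apply/eqP; rewrite -subr_eq0; apply/eqP.
pose B' f g := B g f.
have lB' : bilin B' by split=> *; [exact: lB.2 | exact: lB.1].
have bB' : unit_bounded B' M by move=> f g f1 g1; exact: bB.
have oB' : orthosym B' by move=> f g fg; apply: oB => t; case: (fg t); [right|left].
suff H N : N%:R * `|B h 1 - B 1 h| <= 6 * M.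
  apply: (@norm_le_eps_eq0 _ _ (6 * M)) => e e0.
  have [N Ne] : exists N : nat, e^-1 < N%:R.
    by exists (Num.bound e^-1); apply: archi_boundP; rewrite invr_ge0 ltW.
  have := H N; have : 1 <= N%:R * e by rewrite -ler_pdivrMr ?div1r // ltW.
  set D := `|_| => Ne1 HN.
  have := normr_ge0 (B h 1 - B 1 h); rewrite -/D; nra.
pose y := N%:R *: h.
have yE : y = \sum_(k < N) cramp y k.+1.
  apply: cfun_ext => t; rewrite cfun_sumE.
  under eq_bigr do rewrite crampE.
  have /andP[h0 h1] := h01 t.
  by rewrite sum_ramp ?cfunZE ?mulr_ge0 // min_l // ler_piMr.
(* Only the hats k + 1 and k survive: a ramp is its own hat plus the next ramp,
   and a ramp is disjoint from 1 minus an earlier ramp. *)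
have step k : B (cramp y k.+1) 1 - B 1 (cramp y k.+1) =
    B (chat y k.+1) (chat y k) - B (chat y k) (chat y k.+1).
  have E (B0 : C -> C -> R) : bilin B0 -> orthosym B0 ->
      B0 (cramp y k.+1) (1 - cramp y k.+1) = B0 (chat y k.+1) (chat y k).
    move=> l0 o0.
    have -> : 1 - cramp y k.+1 = (1 - cramp y k) + chat y k by rewrite /chat addrA subrK.
    have -> : cramp y k.+1 = chat y k.+1 + cramp y k.+2 by rewrite /chat subrK.
    have c_split : chat y k.+1 + cramp y k.+2 = cramp y k.+1 by rewrite /chat subrK.
    rewrite (bilinDr l0) {1}c_split o0 ?add0r.
      rewrite (bilinDl l0) [X in _ + X]o0 ?addr0 // => t.
      rewrite crampE chatE; have [yk|yk] := leP (y t) k.+1%:R.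
        by left; exact: ramp_0.
      by right; rewrite /hat !ramp_1 ?subrr ?ltW //; move: yk; rewrite -natr1; lra.
    move=> t; rewrite cfunDE cfunNE !crampE; have [yk|yk] := leP (y t) k%:R.
      by left; exact: ramp_0.
    by right; rewrite ramp_1 ?subrr // ltW.
  have E' : B (1 - cramp y k.+1) (cramp y k.+1) = B (chat y k) (chat y k.+1).
    exact: (E B').
  rewrite -(E B) // -E' (bilinBr lB oB) (bilinBl lB oB); ring.
have -> : N%:R * `|B h 1 - B 1 h| = `|B y 1 - B 1 y|.
  by rewrite (bilinZl lB oB) (bilinZr lB oB) -mulrBr normrM ger0_norm.
rewrite yE (bilin_suml lB oB) (bilin_sumr lB oB) -sumrB.
under eq_bigr do rewrite step.
rewrite sumrB; apply: le_trans (ler_normB _ _) _.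
have := sum_neighbours_bounded lB bB oB y N.
have := sum_neighbours_bounded lB' bB' oB' y N.
by rewrite !big_mkord /B'; lra.
Qed.

(** Both sides are affine in [h], which reduces the claim to [0 <= h <= 1]. *)
Lemma bilin_swap B M (h : C) : bilin B -> unit_bounded B M -> orthosym B -> B h 1 = B 1 h.
Proof.
move=> lB bB oB; have [a [b [k [k01 ->]]]] := cfun_span01 K_compact h.
by rewrite (bilinDl lB) (bilinDr lB) !(bilinZl lB oB) !(bilinZr lB oB)
  (bilin_swap01 lB bB oB k01).
Qed.

Hypothesis K_nonempty : [set: K] !=set0.
Variable n : nat.
Variable A : nform R K n.
Hypotheses (lA : mlin A) (sA : sym A) (bA : bounded_form A).
Hypothesis oA : orthogonally_additive (diag_poly A).
Implicit Types (x : 'I_n -> C).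

(** Multiplying the entries [i] and [j] by variable functions turns [A] into a
bilinear form that vanishes on disjoint pairs, to which the previous lemma
applies. *)
Lemma move_factor x i j (h : C) : i != j ->
  A (upd x i (h * x i)) = A (upd x j (h * x j)).
Proof.
move=> ij; pose B f g := A (upd (upd x i (f * x i)) j (g * x j)).
have lB : bilin B.
  split=> a u v f; rewrite /B.
    by rewrite !(updC _ _ _ ij) mulrDl cfun_scaleAl lA.
  by rewrite mulrDl cfun_scaleAl lA.
have oB : orthosym B.
  move=> f g fg; apply: (disjoint_entries_eq0 lA sA oA K_compact K_nonempty bA ij).
  apply/cfun_disjointP => t; rewrite upd_ne // !upd_eq !cfunE.
  by case: (fg t) => ->; rewrite mul0r; [left|right].
have [M AM] := bA.
have bB : unit_bounded B (`|M| * \prod_(k < n) supnorm (x k)).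
  have le1 (u v : C) : (forall t, `|u t| <= 1) -> supnorm (u * v) <= supnorm v.
    move=> u1; apply: supnorm_le => // t; rewrite cfunE normrM.
    by apply: le_trans (le_supnorm K_compact v t); rewrite ler_piMl.
  move=> f g f1 g1; apply: le_trans (AM _) _.
  have p0 : 0 <= \prod_(k < n) supnorm (upd (upd x i (f * x i)) j (g * x j) k).
    by rewrite prodr_ge0 // => k _; exact: supnorm_ge0.
  apply: le_trans (ler_wpM2r p0 (ler_norm M)) _.
  rewrite ler_wpM2l //; apply: ler_prod => k _; rewrite supnorm_ge0 //=.
  rewrite /upd; case: eqVneq => [->|_]; first exact: le1.
  by case: eqVneq => [->|_] //; exact: le1.
have := bilin_swap h lB bB oB.
by rewrite /B !mul1r (updC _ (h * x i) _ ij) !upd_id.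
Qed.

(** Collecting all the factors in one entry shows that [A x] depends on the
product of the [x i] only. *)
Lemma form_of_product x i0 :
  A x = A (upd (fun=> 1 : C) i0 (\prod_i x i : C)).
Proof.
pose F (s : seq 'I_n) i : C := if i == i0 then x i0 * \prod_(k <- s) x k
  else if i \in s then 1 else x i.
have FE s : uniq s -> i0 \notin s -> A x = A (F s).
  elim: s => [_ _|k s IH /= /andP[ks us]].
    congr A; apply/funext => i; rewrite /F big_nil mulr1 in_nil.
    by case: eqVneq => [->|].
  rewrite inE negb_or => /andP[ik is_].
  rewrite IH //.
  have ki : k != i0 by rewrite eq_sym.
  have Fk : F s k = x k by rewrite /F (negPf ki) (negPf ks).
  have -> : F s = upd (upd (F s) k 1) k (x k * upd (F s) k 1 k).
    by rewrite upd_upd upd_eq mulr1 -Fk upd_id.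
  rewrite (move_factor _ _ ki); congr A; apply/funext => i.
  rewrite /upd /F big_cons inE; case: (eqVneq i i0) => [_|ii].
    by rewrite eqxx (eq_sym i0) (negPf ki) mulrCA.
  by case: (eqVneq i k).
pose s := [seq k <- enum 'I_n | k != i0].
have sE i : (i \in s) = (i != i0) by rewrite mem_filter mem_enum andbT.
have us : uniq s by rewrite filter_uniq // enum_uniq.
rewrite (FE s us) ?sE ?eqxx //.
congr A; apply/funext => i; rewrite /F /upd sE.
case: eqVneq => // _; rewrite (bigD1 i0) //=; congr (_ * _).
by rewrite big_filter big_enum_cond.
Qed.

End Balance.

(** * Representation by bounded linear functionals *)

Section Representation.
Variables (R : realType) (K : topologicalType) (n : nat).
Local Notation C := (cfun R K).
Hypothesis K_compact : compact [set: K].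
Hypothesis K_nonempty : [set: K] !=set0.
Implicit Types (f g : C) (phi : C -> R) (P : C -> R) (M : R).

Definition lin phi := forall a f g, phi (a *: f + g) = a * phi f + phi g.

(** A one-sided bound suffices because the unit ball is symmetric: for a linear
[phi] this says that the norm of [phi] is at most [M]. *)
Definition unit_bound phi M := forall g, (forall t, `|g t| <= 1) -> phi g <= M.

Section Linear.
Variable phi : C -> R.
Hypothesis lphi : lin phi.

Lemma linD f g : phi (f + g) = phi f + phi g.
Proof. by have := lphi 1 f g; rewrite scale1r mul1r. Qed.

Lemma lin0 : phi 0 = 0.
Proof. by have := linD 0 0; rewrite addr0; lra. Qed.

Lemma linZ a f : phi (a *: f) = a * phi f.
Proof. by have := lphi a f 0; rewrite lin0 !addr0. Qed.

Lemma linN f : phi (- f) = - phi f.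
Proof. by rewrite -scaleN1r linZ mulN1r. Qed.

Lemma linB f g : phi (f - g) = phi f - phi g.
Proof. by rewrite linD linN. Qed.

Lemma unit_bound_norm M f : unit_bound phi M -> `|phi f| <= M * supnorm f.
Proof.
move=> bphi.
have [f0|f0] := eqVneq (supnorm f) 0.
  rewrite f0 mulr0; suff -> : f = 0 by rewrite lin0 normr0.
  apply: cfun_ext => t; apply/eqP; rewrite -normr_le0.
  by rewrite -f0 le_supnorm.
have s0 : 0 < supnorm f by rewrite lt0r f0 supnorm_ge0.
have H g : (forall t, `|g t| <= supnorm f) -> phi g <= M * supnorm f.
  move=> gf; rewrite -ler_pdivrMr // mulrC -linZ; apply: bphi => t.
  by rewrite cfunE normrM gtr0_norm ?invr_gt0 // ler_pdivrMl // mulr1.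
rewrite ler_norml; apply/andP; split; last by apply: H; exact: le_supnorm.
rewrite lerNl -linN; apply: H => t.
by rewrite cfunE normrN le_supnorm.
Qed.

End Linear.

Lemma lin_opp phi : lin phi -> lin (- phi).
Proof. by move=> l a f g; rewrite /= !fctE l; lra. Qed.

Definition pow_form phi : nform R K n := fun x => phi (\prod_i x i).

Definition pow_poly phi : C -> R := fun x => phi (x ^+ n).

Lemma pow_form_diag phi : diag_poly (pow_form phi) = pow_poly phi.
Proof.
by apply/funext => x; rewrite /diag_poly /pow_form prodr_const card_ord.
Qed.

Lemma prod_upd (x : 'I_n -> C) i v :
  \prod_j upd x i v j = v * \prod_(j < n | j != i) x j.
Proof.
rewrite (bigD1 i) //= upd_eq; congr (_ * _).
by apply: eq_bigr => j ji; rewrite upd_ne.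
Qed.

Lemma pow_form_mlin phi : lin phi -> mlin (pow_form phi).
Proof.
by move=> l i x a u v; rewrite /pow_form !prod_upd mulrDl cfun_scaleAl l.
Qed.

Lemma pow_form_sym phi : sym (pow_form phi).
Proof.
move=> s x; rewrite /pow_form; congr phi.
by rewrite [RHS](reindex_inj (@perm_inj _ s)).
Qed.

Lemma pow_form_bounded phi M : lin phi -> unit_bound phi M ->
  bounded_form (pow_form phi).
Proof.
move=> l b; exists M => x; apply: le_trans (unit_bound_norm l _ b) _.
have M0 : 0 <= M.
  by rewrite -(lin0 l); apply: b => t; rewrite cfunE normr0.
rewrite ler_wpM2l //; apply: supnorm_le => // t; rewrite cfun_prodE normr_prod.
by apply: ler_prod => i _; rewrite normr_ge0 le_supnorm.
Qed.

Lemma pow_form_associated phi M : lin phi -> unit_bound phi M ->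
  associated_form (pow_poly phi) (pow_form phi).
Proof.
move=> l b; split; [exact: pow_form_mlin|exact: pow_form_bounded l b| |].
  exact: pow_form_sym.
by rewrite pow_form_diag.
Qed.

Lemma associated_form_inj P (A B : nform R K n) :
  associated_form P A -> associated_form P B -> A = B.
Proof.
move=> [lA _ sA PA] [lB _ sB PB]; apply: (sym_diag_inj lA lB sA sB) => y.
by rewrite -[LHS]/(diag_poly A y) -PA PB.
Qed.

Lemma symmetrization P : hom_polynomial n P -> exists A : nform R K n, associated_form P A.
Proof.
move=> [A [lA [M AM] PA]].
have fn0 : (#|{: 'S_n}|%:R : R) != 0.
  by rewrite pnatr_eq0 -lt0n; apply/card_gt0P; exists 1%g.
pose A' : nform R K n := fun x => #|{: 'S_n}|%:R^-1 * \sum_(s : 'S_n) A (x \o s).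
exists A'; split.
- move=> i x a u v.
  have E (s : 'S_n) w : upd x i w \o s = upd (x \o s) (s^-1%g i) w.
    apply/funext => j; rewrite /upd /= (canF_eq (permK s)) //.
  rewrite -/(upd x i (a *: u + v)) -/(upd x i u) -/(upd x i v) /A'.
  rewrite mulrCA -mulrDr; congr (_ * _); rewrite mulr_sumr -big_split /=.
  by apply: eq_bigr => s _; rewrite !E; exact: (lA : mlin A).
- exists M => x; rewrite /A' normrM ger0_norm ?invr_ge0 ?ler0n //.
  rewrite ler_pdivrMl ?lt0r ?fn0 ?ler0n //.
  apply: le_trans (ler_norm_sum _ _ _) _.
  rewrite mulr_natl -sumr_const; apply: ler_sum => s _.
  apply: le_trans (AM _) _.
  by rewrite [in leRHS](reindex_inj (@perm_inj _ s)).
- move=> p x; rewrite /A'; congr (_ * _).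
  rewrite [RHS](reindex_inj (mulIg p)); apply: eq_bigr => s _.
  by congr A; apply/funext => i /=; rewrite permM.
- rewrite PA; apply/funext => x; rewrite /diag_poly /A'.
  rewrite (eq_bigr (fun=> A (fun=> x))) // sumr_const.
  by rewrite -[X in _ * X]mulr_natl mulrA mulVf // mul1r.
Qed.

Hypothesis n_gt0 : (0 < n)%N.

Lemma pow_poly_orth phi M : lin phi -> unit_bound phi M ->
  orth_polynomial n (pow_poly phi).
Proof.
move=> l b; have [lA bA _ PA] := pow_form_associated l b; split.
  by exists (pow_form phi).
move=> x y /cfun_disjointP xy; rewrite /pow_poly -linD //; congr phi.
apply: cfun_ext => t; rewrite !(cfunXE, cfunDE).
by case: (xy t) => ->; rewrite expr0n gtn_eqF // ?add0r ?addr0.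
Qed.

(** The functional is the symmetric form with all entries but one equal to the
constant 1, because the form only depends on the product of its entries. *)
Lemma orth_polynomial_rep P : orth_polynomial n P ->
  exists phi M, [/\ lin phi, unit_bound phi M & P = pow_poly phi].
Proof.
move=> [/symmetrization[A [lA bA sA PA]] oP].
pose i0 := Ordinal n_gt0.
have oA : orthogonally_additive (diag_poly A) by rewrite -PA.
pose phi f := A (upd (fun=> 1 : C) i0 f).
have [M M0 AM] := bounded_form_entry K_compact K_nonempty bA (fun=> 1) i0.
exists phi, M; split.
- by move=> a f g; exact: (lA : mlin A).
- move=> g g1; apply: le_trans (ler_norm _) _; apply: le_trans (AM g) _.
  by rewrite -[leRHS]mulr1 ler_wpM2l // supnorm_le.
- rewrite PA; apply/funext => x; rewrite -pow_form_diag /diag_poly /pow_form.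
  exact: (form_of_product K_compact K_nonempty lA sA bA oA).
Qed.

(** Uniqueness of the symmetric form makes [phi (x_1 ... x_n)] a function of the
polynomial [phi (x ^+ n)], and all the [x_i] but one may be taken equal to 1;
no n-th roots are required. *)
Lemma pow_poly_inj phi psi M M' : lin phi -> unit_bound phi M ->
  lin psi -> unit_bound psi M' -> pow_poly phi = pow_poly psi -> phi = psi.
Proof.
move=> l b l' b' E.
have := pow_form_associated l b; rewrite E => /associated_form_inj.
move=> /(_ _ (pow_form_associated l' b')) H; apply/funext => f.
have := congr1 (fun A => A (upd (fun=> 1 : C) (Ordinal n_gt0) f)) H.
by rewrite /pow_form prod_upd big1 // mulr1.
Qed.

End Representation.

(** * The modulus of a functional and the absolute value of a polynomial *)

Section Modulus.
Variables (R : realType) (K : topologicalType).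
Local Notation C := (cfun R K).
Hypothesis K_compact : compact [set: K].
Hypothesis K_nonempty : [set: K] !=set0.
Implicit Types (f g p q : C) (phi psi : C -> R) (M c : R).

Definition dominated f : set C := [set g | forall t, `|g t| <= f t].

(** The value of the modulus at a positive [f] is the supremum of [phi] over the
functions between [- f] and [f]. *)
Definition is_modulus phi psi := lin psi /\ forall f, cfun_ge0 f ->
  (forall g, dominated f g -> phi g <= psi f) /\
  (forall c, (forall g, dominated f g -> phi g <= c) -> psi f <= c).

Section Existence.
Variables (phi : C -> R) (M : R).
Hypotheses (lphi : lin phi) (bphi : unit_bound phi M).

Let m f := sup [set phi g | g in dominated f].

Lemma dominated_le f g : dominated f g -> phi g <= m f.
Proof.
move=> gf; apply: ub_le_sup; last by exists g.
have M0 : 0 <= M by rewrite -(lin0 lphi); apply: bphi => t; rewrite cfunE normr0.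
exists (M * supnorm f) => _ [h hf <-].
apply: le_trans (ler_norm _) _.
apply: le_trans (unit_bound_norm K_compact K_nonempty lphi h bphi) _.
rewrite ler_wpM2l //; apply: supnorm_le => // t.
exact: le_trans (hf t) (le_trans (ler_norm _) (le_supnorm K_compact f t)).
Qed.

Lemma dominated_sup_le f c : cfun_ge0 f ->
  (forall g, dominated f g -> phi g <= c) -> m f <= c.
Proof.
move=> f0 H; apply: ge_sup => [|_ [g gf <-]]; last exact: H.
by exists (phi 0), 0 => // t; rewrite cfunE normr0; exact: f0.
Qed.

(** Riesz decomposition: a function dominated by [p + q] is the sum of its
truncation to values between [- p] and [p] and a remainder dominated by [q]. *)
Lemma dominated_supD p q : cfun_ge0 p -> cfun_ge0 q -> m (p + q) = m p + m q.
Proof.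
move=> p0 q0.
have pq0 : cfun_ge0 (p + q) by move=> t; rewrite cfunE addr_ge0.
apply/eqP; rewrite eq_le; apply/andP; split.
  apply: dominated_sup_le => // g gpq.
  pose h := cmax (cmin g p) (- p).
  have hE t : h t = Num.max (Num.min (g t) (p t)) (- p t) by [].
  rewrite -[g](subrK h) linD // addrC; apply: lerD; apply: dominated_le => t.
    have := p0 t; rewrite hE => pt; rewrite ler_norml.
    case: (leP (g t) (p t)); [case: (leP (g t) (- p t))|case: (leP (p t) (- p t))]; lra.
  have := gpq t; have := p0 t; have := q0 t.
  rewrite !cfunDE cfunNE hE !ler_norml => qt pt.
  case: (leP (g t) (p t)); [case: (leP (g t) (- p t))|case: (leP (p t) (- p t))]; lra.
rewrite -lerBrDr; apply: dominated_sup_le => // g gp.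
rewrite lerBrDr addrC -lerBrDr; apply: dominated_sup_le => // h hq.
rewrite lerBrDr -linD //; apply: dominated_le => t; rewrite !cfunDE.
by rewrite [leRHS]addrC; apply: le_trans (ler_normD _ _) (lerD (hq t) (gp t)).
Qed.

Lemma dominated_supZ a p : 0 <= a -> cfun_ge0 p -> m (a *: p) = a * m p.
Proof.
move=> a0 p0.
have le_supZ b f : 0 < b -> cfun_ge0 f -> m (b *: f) <= b * m f.
  move=> b0 f0; apply: dominated_sup_le => [t|g gf].
    by rewrite cfunE mulr_ge0 // ltW.
  rewrite -ler_pdivrMl // -linZ //; apply: dominated_le => t.
  by rewrite cfunE normrM gtr0_norm ?invr_gt0 // ler_pdivrMl //; exact: gf.
have [->|an0] := eqVneq a 0.
  rewrite scale0r mul0r; apply/eqP; rewrite eq_le; apply/andP; split.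
    apply: dominated_sup_le => // g g0; rewrite (_ : g = 0) ?lin0 //.
    by apply: cfun_ext => t; apply/eqP; rewrite -normr_le0; exact: g0.
  by rewrite -(lin0 lphi); apply: dominated_le => t; rewrite cfunE normr0.
have ap : 0 < a by rewrite lt0r an0.
apply/eqP; rewrite eq_le le_supZ //= -ler_pdivlMl //.
rewrite -[in leLHS](scalerK an0 p) le_supZ ?invr_gt0 //.
by move=> t; rewrite cfunE mulr_ge0.
Qed.

Let psi f := m (cmax f 0) - m (cmax (- f) 0).

Lemma cmax0_ge0 f : cfun_ge0 (cmax f 0).
Proof. by move=> t; rewrite !cfunE le_max lexx orbT. Qed.

(** As [m] is additive on the cone, the difference [m p - m q] only depends on
[p - q]; linearity of [psi] then reduces to that of [m] on the cone. *)
Lemma modulus_sub p q : cfun_ge0 p -> cfun_ge0 q -> psi (p - q) = m p - m q.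
Proof.
move=> p0 q0; rewrite /psi; set f := p - q.
have E : cmax f 0 + q = p + cmax (- f) 0.
  apply: cfun_ext => t; rewrite /f !cfunE.
  by case: (leP (p t - q t) 0); case: (leP (- (p t - q t)) 0); lra.
have := congr1 m E; rewrite !dominated_supD //; try exact: cmax0_ge0.
lra.
Qed.

Lemma modulus_exists : exists psi, is_modulus phi psi.
Proof.
exists psi; split.
  move=> a f g.
  rewrite {1}(cfun_posneg f) {1}(cfun_posneg g).
  set fp := cmax f 0; set fn := cmax (- f) 0.
  set gp := cmax g 0; set gn := cmax (- g) 0.
  have fp0 : cfun_ge0 fp by exact: cmax0_ge0.
  have fn0 : cfun_ge0 fn by exact: cmax0_ge0.
  have gp0 : cfun_ge0 gp by exact: cmax0_ge0.
  have gn0 : cfun_ge0 gn by exact: cmax0_ge0.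
  have Z b h : 0 <= b -> cfun_ge0 h -> cfun_ge0 (b *: h).
    by move=> b0 h0 t; rewrite cfunE mulr_ge0.
  have D h k : cfun_ge0 h -> cfun_ge0 k -> cfun_ge0 (h + k).
    by move=> h0 k0 t; rewrite cfunE addr_ge0.
  rewrite /psi -/fp -/fn -/gp -/gn -/(psi _).
  have [a0|a0] := leP 0 a.
    have -> : a *: (fp - fn) + (gp - gn) = (a *: fp + gp) - (a *: fn + gn).
      by apply: cfun_ext => t; rewrite !(cfunDE, cfunNE, cfunZE); ring.
    rewrite modulus_sub; try by auto.
    rewrite !dominated_supD; try by auto.
    by rewrite !dominated_supZ //; ring.
  have na0 : 0 <= - a by rewrite oppr_ge0 ltW.
  have -> : a *: (fp - fn) + (gp - gn) = (- a *: fn + gp) - (- a *: fp + gn).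
    by apply: cfun_ext => t; rewrite !(cfunDE, cfunNE, cfunZE); ring.
  rewrite modulus_sub; try by auto.
  rewrite !dominated_supD; try by auto.
  by rewrite !dominated_supZ //; ring.
move=> f f0.
have psiE : psi f = m f.
  have := modulus_sub f0 (fun t => lexx 0 : 0 <= (0 : C) t).
  have -> : m 0 = 0 by rewrite -(scale0r f) dominated_supZ // mul0r.
  by rewrite !subr0.
by rewrite psiE; split=> [g|c]; [exact: dominated_le|exact: dominated_sup_le].
Qed.

End Existence.
End Modulus.

Section AbsoluteValue.
Variables (R : realType) (K : topologicalType) (n : nat).
Local Notation C := (cfun R K).
Hypothesis K_compact : compact [set: K].
Hypothesis K_nonempty : [set: K] !=set0.
Hypothesis n_gt0 : (0 < n)%N.
Implicit Types (f g : C) (phi psi P Q : C -> R) (M c : R).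

Lemma prod_ge0 (x : 'I_n -> C) : (forall i, cfun_ge0 (x i)) -> cfun_ge0 (\prod_i x i).
Proof. by move=> x0 t; rewrite cfun_prodE prodr_ge0 // => i _; exact: x0. Qed.

Section OfFunctional.
Variables (phi psi : C -> R) (M : R).
Hypotheses (lphi : lin phi) (bphi : unit_bound phi M) (modphi : is_modulus phi psi).

Let lpsi : lin psi := modphi.1.

Lemma modulus_ge f g : cfun_ge0 f -> dominated f g -> phi g <= psi f.
Proof. by move=> f0; exact: (modphi.2 f f0).1. Qed.

Lemma modulus_ge0 f : cfun_ge0 f -> 0 <= psi f.
Proof.
by move=> f0; rewrite -(lin0 lphi); apply: modulus_ge => // t; rewrite cfunE normr0.
Qed.

Lemma modulus_unit_bound : unit_bound psi (psi 1).
Proof.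
move=> g g1; rewrite -subr_ge0 -linB //; apply: modulus_ge0 => t.
by rewrite cfunDE cfunNE subr_ge0; exact: le_trans (ler_norm _) (g1 t).
Qed.

Let aphi := pow_form_associated n K_compact K_nonempty lphi bphi.
Let aphiN : associated_form (- pow_poly n phi) (pow_form (- phi) : nform R K n).
Proof.
have bN : unit_bound (- phi) M.
  by move=> g g1; rewrite fctE -linN //; apply: bphi => t; rewrite cfunE normrN.
exact: (pow_form_associated n K_compact K_nonempty (lin_opp lphi) bN).
Qed.
Let apsi := pow_form_associated n K_compact K_nonempty lpsi modulus_unit_bound.

Lemma functional_bound0 : 0 <= M.
Proof. by rewrite -(lin0 lphi); apply: bphi => t; rewrite cfunE normr0. Qed.

(** A symmetric form [B] above [phi] and [- phi] need not factor through
products, but multiplying one entry by a function [h] with [|h| <= 1] still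
gives [phi (h X) <= B (|h| x_0, x_1, ...) <= B x] with [X] the product of the
[x i].  Every [g] with [|g| <= X] is uniformly close to such an [h X], with
[h = g / (X + e)]. *)
Lemma modulus_le_form (B : nform R K n) (x : 'I_n -> C) : mlin B ->
  (forall x, (forall i, cfun_ge0 (x i)) -> pow_form phi x <= B x) ->
  (forall x, (forall i, cfun_ge0 (x i)) -> pow_form (- phi) x <= B x) ->
  (forall i, cfun_ge0 (x i)) -> pow_form psi x <= B x.
Proof.
move=> lB phiB phiNB x0.
pose i0 := Ordinal n_gt0.
have B0 y : (forall i, cfun_ge0 (y i)) -> 0 <= B y.
  by move=> y0; have := phiB y y0; have := phiNB y y0; rewrite /pow_form fctE; lra.
have upd0 f : cfun_ge0 f -> forall i, cfun_ge0 (upd x i0 (f * x i0) i).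
  move=> f0 i; rewrite /upd; case: eqVneq => _; last exact: x0.
  by move=> t; rewrite cfunE mulr_ge0 //; exact: x0.
set X := \prod_i x i.
have X0 : cfun_ge0 X by exact: prod_ge0.
have prodX f : \prod_i upd x i0 (f * x i0) i = f * X.
  by rewrite prod_upd -mulrA; congr (f * _); rewrite /X [RHS](bigD1 i0).
apply: (modphi.2 X X0).2 => g gX.
have mult (h : C) : (forall t, `|h t| <= 1) -> phi (h * X) <= B x.
  move=> h1; pose hp := cmax h 0; pose hn := cmax (- h) 0.
  have hp0 : cfun_ge0 hp by exact: cmax0_ge0.
  have hn0 : cfun_ge0 hn by exact: cmax0_ge0.
  have := phiB _ (upd0 _ hp0); have := phiNB _ (upd0 _ hn0).
  rewrite /pow_form !prodX fctE.
  pose k : C := 1 - (hp + hn).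
  have k0 : cfun_ge0 k.
    move=> t; have := h1 t; rewrite /k /hp /hn !cfunE ler_norml.
    by case: (leP (h t) 0); case: (leP (- h t) 0); lra.
  have Bk := B0 _ (upd0 k k0).
  have -> : h = hp - hn by exact: cfun_posneg.
  have -> : B x = B (upd x i0 (k * x i0)) + (B (upd x i0 (hp * x i0)) +
      B (upd x i0 (hn * x i0))).
    by rewrite -!mlinD // -!mulrDl subrK mul1r upd_id.
  by rewrite mulrBl linB //; lra.
apply/ler_addgt0Pl => e e0.
have M1 : 0 < M + 1 by rewrite ltr_wpDl // functional_bound0.
pose d := e / (M + 1).
have d0 : 0 < d by rewrite divr_gt0.
have Xd t : (X + ccst K d) t != 0.
  by rewrite gt_eqF // !cfunE ltr_wpDl //; exact: X0.
pose h := g * cinv Xd.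
have hE t : h t = g t / (X t + d) by [].
have Xdt t : 0 < X t + d by rewrite ltr_wpDl //; exact: X0.
have h1 t : `|h t| <= 1.
  rewrite hE normrM normfV (gtr0_norm (Xdt t)) ler_pdivrMr // mul1r.
  by apply: le_trans (gX t) _; rewrite lerDl ltW.
rewrite -[g](subrK (h * X)) linD //; apply: lerD; last exact: mult.
apply: le_trans (ler_norm _) _.
apply: le_trans (unit_bound_norm K_compact K_nonempty lphi _ bphi) _.
have : supnorm (g - h * X) <= d.
  apply: supnorm_le => // t; rewrite cfunDE cfunNE cfunME hE.
  have -> : g t - g t / (X t + d) * X t = d * (g t / (X t + d)).
    by field; rewrite gt_eqF.
  by rewrite normrM gtr0_norm // ler_piMr ?(ltW d0) //; exact: h1.
move=> gd; apply: (@le_trans _ _ (M * d)).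
  by rewrite ler_wpM2l // functional_bound0.
by rewrite /d mulrCA ger_pMr // ler_pdivrMr // mul1r lerDl.
Qed.

Lemma pow_poly_abs : is_poly_abs n (pow_poly n phi) (pow_poly n psi).
Proof.
have self f : cfun_ge0 f -> dominated f f by move=> f0 t; rewrite ger0_norm.
split.
- by have [lA bA _ PA] := apsi; exists (pow_form psi).
- exists (pow_form phi), (pow_form psi); split=> // x /prod_ge0 x0.
  by apply: modulus_ge => //; exact: self.
- exists (pow_form (- phi)), (pow_form psi); split=> // x /prod_ge0 x0.
  rewrite /pow_form fctE -linN //; apply: modulus_ge => // t.
  by rewrite cfunE normrN; exact: self.
- move=> S hS [A [B [aA aB AB]]] [A' [B' [aA' aB' AB']]].
  exists (pow_form psi), B; split=> // x x0.
  have [lB _ _ _] := aB.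
  apply: modulus_le_form => //.
    by rewrite (associated_form_inj aphi aA).
  by rewrite (associated_form_inj aphiN aA') (associated_form_inj aB aB').
Qed.

End OfFunctional.

(** The two symmetric forms agree on positive functions, which span. *)
Lemma poly_le_anti P Q : poly_le n P Q -> poly_le n Q P -> P = Q.
Proof.
move=> [A [B [aA aB AB]]] [B' [A' [aB' aA' BA]]].
rewrite -(associated_form_inj aA aA') -(associated_form_inj aB aB') in BA.
have [lA _ _ ->] := aA; have [lB _ _ ->] := aB.
suff -> : A = B by [].
apply/funext => x; apply/eqP; rewrite -subr_eq0; apply/eqP.
apply: (mlin_cone_eq0 (S := @cfun_ge0 R K) (mlin_sub lA lB)) => [v|y y0].
  by exists (cmax v 0), (cmax (- v) 0); split;
    [exact: cmax0_ge0|exact: cmax0_ge0|exact: cfun_posneg].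
by apply/eqP; rewrite subr_eq0 eq_le AB // BA.
Qed.

Lemma poly_abs_unique P Q : is_poly_abs n P Q -> poly_abs n P = Q.
Proof.
move=> absQ; apply: xget_subset1 => // S T [hS PS NS leS] [hT PT NT leT].
by apply: poly_le_anti; [exact: leS|exact: leT].
Qed.

(** The modulus is positive, so the norm of its polynomial is attained at the
constant 1. *)
Lemma regular_norm_modulus phi psi M : lin phi -> unit_bound phi M ->
  is_modulus phi psi -> regular_norm n (pow_poly n phi) = psi 1.
Proof.
move=> lphi bphi modphi.
rewrite /regular_norm (poly_abs_unique (pow_poly_abs lphi bphi modphi)).
have psi_bound := modulus_unit_bound lphi modphi.
have ub (x : C) : supnorm x <= 1 -> `|pow_poly n psi x| <= psi 1.
  move=> /(supnorm_leP K_compact K_nonempty) x1.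
  have xn1 t : `|(x ^+ n) t| <= 1 by rewrite cfunXE normrX exprn_ile1.
  rewrite ler_norml psi_bound // andbT lerNl -(linN modphi.1).
  by apply: psi_bound => t; rewrite cfunE normrN.
have one1 : supnorm (1 : C) <= 1 by apply: supnorm_le => // t; rewrite cfunE normr1.
have psi1 : 0 <= psi 1 by apply: (modulus_ge0 lphi modphi) => t; exact: ler01.
apply/eqP; rewrite eq_le; apply/andP; split.
  apply: ge_sup; first by exists `|pow_poly n psi 1|, 1.
  by move=> _ [x x1 <-]; exact: ub.
apply: ub_le_sup; first by exists (psi 1) => _ [x x1 <-]; exact: ub.
by exists 1 => //; rewrite /pow_poly expr1n ger0_norm.
Qed.

Lemma regular_unit_ballE : regular_unit_ball n =
  [set pow_poly n phi | phi in [set phi : C -> R | lin phi /\ unit_bound phi 1]].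
Proof.
apply/seteqP; split=> [P [oP nP]|_ [phi [lphi bphi] <-]].
  have [phi [M [lphi bphi PE]]] := orth_polynomial_rep K_compact K_nonempty n_gt0 oP.
  exists phi => //; split=> // g g1.
  have [psi modphi] := modulus_exists K_compact K_nonempty lphi bphi.
  rewrite PE (regular_norm_modulus lphi bphi modphi) in nP.
  by apply: le_trans nP; apply: (modulus_ge modphi) => t //; exact: ler01.
split; first exact: (pow_poly_orth K_compact K_nonempty n_gt0 lphi bphi).
have [psi modphi] := modulus_exists K_compact K_nonempty lphi bphi.
rewrite (regular_norm_modulus lphi bphi modphi).
by apply: (modphi.2 1 _).2 => [t|g g1]; [exact: ler01|exact: bphi].
Qed.

End AbsoluteValue.

(** * Extreme points of the dual ball *)

Section DualBall.
Variables (R : realType) (K : topologicalType).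
Local Notation C := (cfun R K).
Hypothesis K_compact : compact [set: K].
Hypothesis K_nonempty : [set: K] !=set0.
Implicit Types (f g h : C) (phi psi : C -> R) (t : K).

Definition dual_ball : set (C -> R) := [set phi | lin phi /\ unit_bound phi 1].

Definition dirac_at t : C -> R := fun f => f t.

Lemma dual_ball_dirac t : dual_ball (dirac_at t).
Proof. by split=> // g g1; exact: le_trans (ler_norm _) (g1 t). Qed.

Lemma dual_ball_opp phi : dual_ball phi -> dual_ball (- phi).
Proof.
move=> [l b]; split; first exact: lin_opp.
by move=> g g1; rewrite fctE -linN //; apply: b => t; rewrite cfunE normrN.
Qed.

Lemma dual_ball_positive phi f : dual_ball phi -> phi 1 = 1 -> cfun_ge0 f ->
  0 <= phi f.
Proof.
move=> [l b] phi1 f0; have [c [c0 fc]] := cfun_bounded K_compact f.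
have c1 : 0 < c + 1 by rewrite ltr_wpDl.
suff : phi (1 - (c + 1)^-1 *: f) <= 1.
  by rewrite linB // linZ // phi1 gerBl pmulr_rge0 // invr_gt0.
apply: b => t; rewrite cfunDE cfunNE cfunZE cfun1E ler_norml.
have := f0 t; have := fc t; rewrite ler_norml => /andP[_ ft] ft0.
have : (c + 1)^-1 * f t <= 1 by rewrite ler_pdivrMl // mulr1; lra.
have : 0 <= (c + 1)^-1 * f t by rewrite mulr_ge0 // invr_ge0 ltW.
lra.
Qed.

(** Two functionals of the ball averaging to the evaluation at [t] both take
the value 1 at the constant 1, hence are positive, hence vanish with the
evaluation. *)
Lemma dirac_extreme t : extreme_points dual_ball (dirac_at t).
Proof.
split; first exact: dual_ball_dirac.
move=> u w a Bu Bw /andP[a0 a1] E.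
have avg f : f t = a * u f + (1 - a) * w f by exact: (congr1 (fun v => v f) E).
have le1 v : dual_ball v -> v 1 <= 1.
  by move=> [_ b]; apply: b => s; rewrite cfunE normr1.
have u1 : u 1 = 1.
  by have := avg 1; rewrite cfun1E; have := le1 u Bu; have := le1 w Bw; nra.
have w1 : w 1 = 1.
  by have := avg 1; rewrite cfun1E u1; have := le1 w Bw; nra.
have pos0 f : cfun_ge0 f -> f t = 0 -> u f = 0 /\ w f = 0.
  move=> f0 ft; have := avg f; rewrite ft.
  have := dual_ball_positive Bu u1 f0; have := dual_ball_positive Bw w1 f0.
  by split; nra.
suff D v : dual_ball v -> v 1 = 1 ->
    (forall f, cfun_ge0 f -> f t = 0 -> v f = 0) -> v = dirac_at t.
  by split; apply: D => // f f0 ft; have [] := pos0 f f0 ft.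
move=> [l _] v1 v0; apply/funext => f; rewrite /dirac_at.
pose g := f - f t *: (1 : C).
have gt0 : g t = 0 by rewrite cfunDE cfunNE cfunZE cfun1E mulr1 subrr.
have -> : f = g + f t *: (1 : C) by rewrite subrK.
rewrite linD // linZ // v1 mulr1 cfunDE cfunZE cfun1E mulr1 gt0 add0r.
rewrite (cfun_posneg g) linB // !v0 ?subrr ?add0r //; try exact: cmax0_ge0.
  by rewrite cmaxE cfunNE gt0 oppr0 cfun0E maxxx.
by rewrite cmaxE gt0 cfun0E maxxx.
Qed.

(** A multiplicative functional is an evaluation: the zero sets of the
functions in its kernel are nonempty, because an invertible function cannot be
in the kernel, and they are closed under finite intersections as
[f ^+ 2 + g ^+ 2] vanishes exactly where both [f] and [g] do.  Compactness
gives a common zero. *)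
Lemma multiplicative_dirac phi : lin phi -> phi 1 = 1 ->
  (forall f g, phi (f * g) = phi f * phi g) -> exists t, phi = dirac_at t.
Proof.
move=> l phi1 phiM.
pose Z f : set K := [set t | f t = 0].
pose F := filter_from [set f | phi f = 0] Z.
have FF : ProperFilter F.
  apply: filter_from_proper.
    apply: filter_from_filter; first by exists 0; exact: lin0.
    move=> f g /= f0 g0; exists (f * f + g * g).
      by rewrite /= linD // !phiM f0 g0 !mul0r addr0.
    move=> t; rewrite /Z /= cfunDE !cfunME => /eqP.
    by rewrite paddr_eq0 -?expr2 ?sqr_ge0 // !sqrf_eq0 => /andP[/eqP ? /eqP ?].
  move=> f f0; apply: contrapT => /forallNP Zf.
  have fn0 t : f t != 0 by apply/eqP; exact: Zf.
  suff : (1 : R) = 0 by move/eqP; rewrite oner_eq0.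
  rewrite -phi1 (_ : 1 = f * cinv fn0) ?phiM ?f0 ?mul0r //.
  by apply: cfun_ext => t; rewrite cfunME cinvE cfun1E mulfV.
have [t [_ Ft]] : [set: K] `&` cluster F !=set0.
  by apply: K_compact; exact: filterT.
have ker f : phi f = 0 -> f t = 0.
  move=> f0; have clZ : closed (Z f).
    rewrite (_ : Z f = f @^-1` [set 0]) //.
    by apply: preimage_closed; [move=> s _; exact: cts_fun | exact: closed_eq].
  by apply: clZ => B tB; apply: Ft => //; exists f.
exists t; apply/funext => f; rewrite /dirac_at.
have := ker (f - phi f *: (1 : C)).
rewrite linB // linZ // phi1 mulr1 subrr cfunDE cfunNE cfunZE cfun1E mulr1.
by move=> /(_ erefl) /eqP; rewrite subr_eq0 => /eqP.
Qed.

(** Splitting [phi = phi (h .) + phi ((1 - h) .)] splits the norm, so that an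
extreme [phi] is proportional to each of the two parts. *)
Lemma extreme_proportional phi h : extreme_points dual_ball phi ->
  (forall t, 0 <= h t <= 1) -> exists c, forall f, phi (h * f) = c * phi f.
Proof.
move=> [[l b] ext] h01.
(* N k is the norm of the functional f |-> phi (k * f) *)
pose N (k : C) := sup [set phi (k * g) | g in dominated 1].
have N_ge (k g : C) : (forall t, `|k t| <= 1) -> (forall t, `|g t| <= 1) ->
    phi (k * g) <= N k.
  move=> k1 g1; apply: ub_le_sup; last by exists g.
  exists 1 => _ [f f1 <-]; apply: b => t; rewrite cfunE normrM.
  by apply: mulr_ile1 => //; exact: f1.
pose k := 1 - h.
have kE t : k t = 1 - h t by [].
have h1 t : `|h t| <= 1 by have := h01 t; rewrite ler_norml; lra.
have k1 t : `|k t| <= 1 by have := h01 t; rewrite kE ler_norml; lra.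
have split_phi f : phi f = phi (h * f) + phi (k * f).
  by rewrite -linD // -mulrDl addrC subrK mul1r.
have N0 (j : C) : (forall t, `|j t| <= 1) -> 0 <= N j.
  move=> j1; rewrite -(lin0 l) -[0](mulr0 j).
  by apply: N_ge => // t; rewrite cfunE normr0.
have Nsum : N h + N k <= 1.
  have ne (j : C) : [set phi (j * g) | g in dominated 1] !=set0.
    by exists (phi (j * 0)), 0 => // t; rewrite !cfunE normr0.
  rewrite -lerBrDr; apply: ge_sup => // _ [f f1 <-].
  rewrite lerBrDr addrC -lerBrDr; apply: ge_sup => // _ [g g1 <-].
  rewrite lerBrDr -linD //; apply: b => t; rewrite cfunDE !cfunME kE.
  have := h01 t; have := f1 t; have := g1 t; rewrite cfun1E !ler_norml.
  move=> /andP[? ?] /andP[? ?] /andP[? ?]; apply/andP; split; nra.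
have part_lin (j : C) a : lin (fun f => a * phi (j * f)).
  by move=> c f g; rewrite mulrDr cfun_scaleAr l; ring.
have part_eq0 (j f : C) : (forall t, `|j t| <= 1) -> N j = 0 -> phi (j * f) = 0.
  move=> j1 Nj; rewrite -[LHS]mul1r; apply/eqP; rewrite -normr_le0.
  have := unit_bound_norm K_compact K_nonempty (part_lin j 1) f (M := 0).
  rewrite mul0r; apply=> g g1; rewrite mul1r -Nj; exact: N_ge.
have := N0 h h1; rewrite le_eqVlt => /orP[/eqP/esym Nh|Nh].
  by exists 0 => f; rewrite mul0r part_eq0.
have := N0 k k1; rewrite le_eqVlt => /orP[/eqP/esym Nk|Nk].
  by exists 1 => f; rewrite mul1r [RHS]split_phi (part_eq0 k) ?addr0.
pose a := N h / (N h + N k).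
have s0 : 0 < N h + N k by rewrite addr_gt0.
have a0 : 0 < a by rewrite divr_gt0.
have a1E : 1 - a = N k / (N h + N k) by rewrite /a; field; rewrite gt_eqF.
have a1 : 0 < 1 - a by rewrite a1E divr_gt0.
have [] := ext (fun f => a^-1 * phi (h * f)) (fun f => (1 - a)^-1 * phi (k * f)) a.
- split=> // g g1; rewrite ler_pdivrMl // mulr1.
  apply: le_trans (N_ge h g h1 g1) _.
  by rewrite ler_pdivlMr // ler_piMr ?(ltW Nh).
- split=> // g g1; rewrite ler_pdivrMl // mulr1 a1E.
  apply: le_trans (N_ge k g k1 g1) _.
  by rewrite ler_pdivlMr // ler_piMr ?(ltW Nk).
- by rewrite a0 /=; lra.
- apply/funext => f; rewrite !fctE /= [LHS]split_phi.
  by rewrite /GRing.scale /= !mulrA !divff ?mul1r ?gt_eqF.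
move=> E _; exists a => f.
by rewrite -[in RHS]E mulrA divff ?mul1r ?gt_eqF.
Qed.

Lemma lin_eq01 phi psi : lin phi -> lin psi ->
  (forall h, (forall t, 0 <= h t <= 1) -> phi h = psi h) -> phi = psi.
Proof.
move=> l l' E; apply/funext => f.
have [a [b [k [k01 ->]]]] := cfun_span01 K_compact f.
rewrite !linD // !linZ // !E // => t.
by rewrite cfun1E ler01 lexx.
Qed.

(** Proportionality says that [phi (h * f) * phi 1 = phi h * phi f], so that
[phi] is either zero or a multiple of a multiplicative functional. *)
Lemma extreme_dirac_scale phi : extreme_points dual_ball phi ->
  exists c t, phi = c *: dirac_at t.
Proof.
move=> Ephi; have [[l b] _] := Ephi.
have prop h : (forall t, 0 <= h t <= 1) ->
    forall f, phi (h * f) * phi 1 = phi h * phi f.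
  move=> h01 f; have [c hc] := extreme_proportional Ephi h01.
  by rewrite hc -[h]mulr1 hc; ring.
have [phi1|phi1] := eqVneq (phi 1) 0.
  have [t _] := K_nonempty; exists 0, t; rewrite scale0r.
  apply: lin_eq01 => // [a f g|h h01]; first by rewrite mulr0 addr0.
  have := prop h h01 h; rewrite phi1 mulr0 => /esym/eqP.
  by rewrite mulf_eq0 orbb => /eqP.
pose chi : C -> R := fun f => (phi 1)^-1 * phi f.
have lchi : lin chi by move=> a f g; rewrite /chi l; ring.
have [t chit] : exists t, chi = dirac_at t.
  apply: multiplicative_dirac => // [|f g]; first by rewrite /chi mulVf.
  suff H : (fun h => chi (h * g)) = (fun h => chi h * chi g).
    exact: (congr1 (fun v => v f) H).
  apply: lin_eq01 => [a u v|a u v|h h01].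
  - by rewrite mulrDl cfun_scaleAl lchi.
  - by rewrite lchi; ring.
  - have := prop h h01 g; rewrite /chi => E.
    have -> : phi (h * g) = phi h * phi g / phi 1 by rewrite -E mulfK.
    by field.
exists (phi 1), t; apply/funext => f.
by rewrite -chit fctE /chi /GRing.scale /= mulrA divff ?mul1r.
Qed.

(** The Arens-Kelley theorem.  A multiple [c] of an evaluation with
[-1 < c < 1] is not extreme, as it lies strictly between two evaluations of
opposite signs. *)
Lemma extreme_points_dual_ball : extreme_points dual_ball =
  [set phi | exists t, phi = dirac_at t \/ phi = - dirac_at t].
Proof.
apply/seteqP; split=> [phi Ephi|phi [t [->|->]]].
- have [c [t phiE]] := extreme_dirac_scale Ephi.
  have [Bphi ext] := Ephi.
  have phi1 : phi 1 = c by rewrite phiE fctE /dirac_at /GRing.scale /= mulr1.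
  have c1 : c <= 1.
    by rewrite -phi1; apply: Bphi.2 => s; rewrite cfunE normr1.
  have cN1 : -1 <= c.
    rewrite lerNl -phi1; apply: (dual_ball_opp Bphi).2 => s.
    by rewrite cfunE normr1.
  exists t; have [cE|cn1] := eqVneq c 1; first by left; rewrite phiE cE scale1r.
  have [cE|cnN1] := eqVneq c (-1); first by right; rewrite phiE cE scaleN1r.
  exfalso.
  have [] := ext (dirac_at t) (- dirac_at t) ((1 + c) / 2).
  + exact: dual_ball_dirac.
  + exact/dual_ball_opp/dual_ball_dirac.
  + have c_lt : c < 1 by rewrite lt_neqAle cn1.
    have c_gt : -1 < c by rewrite lt_neqAle eq_sym cnN1.
    by apply/andP; split; lra.
  + rewrite scalerN -scalerBl phiE; congr (_ *: _); lra.
  + by move=> /(congr1 (fun v => v 1)); rewrite phi1 => /esym/eqP; rewrite (negPf cn1).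
- exact: dirac_extreme.
- have [Bt ext] := dirac_extreme t; split; first exact: dual_ball_opp.
  move=> u w a Bu Bw a01 E.
  have [] := ext (- u) (- w) a (dual_ball_opp Bu) (dual_ball_opp Bw) a01.
    by rewrite !scalerN -opprD -E opprK.
  by move=> uE wE; split; [rewrite -uE opprK | rewrite -wE opprK].
Qed.

Lemma dual_ball_convex phi psi a : dual_ball phi -> dual_ball psi -> 0 < a < 1 ->
  dual_ball (a *: phi + (1 - a) *: psi).
Proof.
move=> [l b] [l' b'] a01; split.
  move=> c f g; rewrite !fctE /GRing.scale /= l l'; ring.
by move=> g g1; rewrite !fctE /GRing.scale /=; have := b g g1; have := b' g g1; nra.
Qed.

End DualBall.

(** * Extreme points of the ball of polynomials *)

Theorem proposition4 (R : realType) (K : topologicalType) (n : nat)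
    (K_compact : compact [set: K]) (K_hausdorff : hausdorff_space K)
    (K_nonempty : [set: K] !=set0) (n_gt0 : (0 < n)%N) :
  extreme_points (regular_unit_ball (R := R) (K := K) n) =
  [set P : cfun R K -> R |
    exists t : K, P = delta_pow n t \/ P = - delta_pow n t].
Proof.
have E := @extreme_points_dual_ball R K K_compact K_nonempty.
have inj (phi psi : cfun R K -> R) : dual_ball phi -> dual_ball psi ->
    pow_poly n phi = pow_poly n psi -> phi = psi.
  by move=> [l b] [l' b']; exact: (pow_poly_inj K_compact K_nonempty n_gt0 l b l' b').
have deltaE t : delta_pow n t = pow_poly n (@dirac_at R K t).
  by apply/funext => x; rewrite /pow_poly /dirac_at cfunXE.
rewrite regular_unit_ballE //; apply/seteqP; split.
  move=> _ [[phi Bphi <-] ext].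
  suff : extreme_points (@dual_ball R K) phi.
    rewrite E => -[t [->|->]]; exists t; rewrite deltaE; first by left.
    by right.
  split=> // u w a Bu Bw a01 phiE.
  have [] := ext (pow_poly n u) (pow_poly n w) a _ _ a01.
  - by exists u.
  - by exists w.
  - by rewrite phiE.
  - by move=> /inj -> // /inj ->.
move=> P [t Pt].
have [phi [Ephi ->]] : exists phi : cfun R K -> R,
    extreme_points (@dual_ball R K) phi /\ P = pow_poly n phi.
  case: Pt => ->; rewrite deltaE.
    by exists (dirac_at t); split=> //; rewrite E; exists t; left.
  by exists (- dirac_at t); split=> //; rewrite E; exists t; right.
have [Bphi ext] := Ephi; split; first by exists phi.
move=> _ _ a [u Bu <-] [w Bw <-] a01 PE.
suff phiE : phi = a *: u + (1 - a) *: w by have [-> ->] := ext u w a Bu Bw a01 phiE.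
by apply: inj => //; exact: dual_ball_convex.
Qed.
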